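(* There is a 2-category $\mathbf{Bicat}_2$ whose objects are bicategories, whose 1-cells are lax functors, and whose 2-cells are icons, with the usual composition laws. These are as follows. (1) 1-cells are composed by the usual composition of lax functors: if $F:\mathscr A\to\mathscr B$ has constraints $\varphi,\varphi^0$ and $H:\mathscr B\to\mathscr C$ has constraints $\chi,\chi^0$, then $HF$ has constraints $H(\varphi_{g,f})\circ\chi_{Fg,Ff}$ and $H(\varphi^0_A)\circ\chi^0_{FA}$. (2) The vertical composite $\beta\alpha:F\to H$ of icons $\alpha:F\to G$ and $\beta:G\to H$, where $F,G,H:\mathscr A\to\mathscr B$, is given by the composite natural transformations $F\to G\to H:\mathscr A(A,B)\to\mathscr B(FA,FB)$. (3) For an icon $\alpha:F\to G:\mathscr A\to\mathscr B$ and lax functors $K:\mathscr D\to\mathscr A$ and $H:\mathscr B\to\mathscr C$, the whiskered icon $H\alpha K:HFK\to HGK$ is given by the whiskered natural transformations $\mathscr D(D,E)\xrightarrow{K}\mathscr A(KD,KE)\overset{\alpha}{\Longrightarrow}\mathscr B(FKD,FKE)\xrightarrow{H}\mathscr C(HFKD,HFKE)$; that is, its component at a 1-cell $f$ of $\mathscr D$ is $H(\alpha_{Kf})$.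
   Context: A lax functor $F:\mathscr A\to\mathscr B$ of bicategories consists of a function $A\mapsto FA$ on objects, functors $F:\mathscr A(A,B)\to\mathscr B(FA,FB)$ on hom-categories, and 2-cells $\varphi_{g,f}:Fg.Ff\to F(gf)$, natural in $f:A\to B$ and $g:B\to C$, and $\varphi^0_A:1_{FA}\to F1_A$, satisfying the usual associativity and unit coherence conditions. The constraints $\varphi,\varphi^0$ are not required to be invertible. Icon: let $F,G:\mathscr A\to\mathscr B$ be lax functors with constraints $(\varphi,\varphi^0)$ and $(\psi,\psi^0)$ respectively, such that $FA=GA$ for all objects $A$ of $\mathscr A$. An icon $\alpha$ from $F$ to $G$ consists of, for all objects $A,B$ of $\mathscr A$, a natural transformation $\alpha:F\to G:\mathscr A(A,B)\to\mathscr B(FA,FB)$, with components 2-cells $\alpha_f:Ff\to Gf$ for 1-cells $f:A\to B$, such that: (ICON1) $\psi_{g,f}\circ(\alpha_g.\alpha_f)=\alpha_{gf}\circ\varphi_{g,f}$ for all 1-cells $f:A\to B$ and $g:B\to C$ of $\mathscr A$, where $\alpha_g.\alpha_f:Fg.Ff\to Gg.Gf$ is the horizontal composite in $\mathscr B$; (ICON2) $\alpha_{1_A}\circ\varphi^0_A=\psi^0_A$ for all objects $A$ of $\mathscr A$. There is an icon from $F$ to $G$ only if $F$ and $G$ agree on objects. *)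

(* Defs.v *)
Set Implicit Arguments.
Unset Strict Implicit.
Unset Printing Implicit Defensive.

Declare Scope cat_scope.
Delimit Scope cat_scope with cat.
Local Open Scope cat_scope.

Reserved Notation "b ∘ a" (at level 40, left associativity).
Reserved Notation "g ⋅ f" (at level 35, right associativity).
Reserved Notation "t ⊗ s" (at level 35, right associativity).

Record Category : Type := {
  obj :> Type;
  hom : obj -> obj -> Type;
  idm : forall x, hom x x;
  compose : forall x y z, hom y z -> hom x y -> hom x z
    where "b ∘ a" := (compose b a);
  compA : forall w x y z (h : hom y z) (g : hom x y) (f : hom w x),
    h ∘ (g ∘ f) = (h ∘ g) ∘ f;
  comp1m : forall x y (f : hom x y), idm y ∘ f = f;
  compm1 : forall x y (f : hom x y), f ∘ idm x = f
}.
Notation "b ∘ a" := (compose b a) : cat_scope.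
Arguments idm {c} x.

Definition is_iso (C : Category) (x y : C) (f : hom x y) : Prop :=
  exists g : hom y x, g ∘ f = idm x /\ f ∘ g = idm y.

Record Functor (C D : Category) : Type := {
  fobj :> C -> D;
  fmap : forall x y, hom x y -> hom (fobj x) (fobj y);
  fmap_id : forall x, fmap (idm x) = idm (fobj x);
  fmap_comp : forall x y z (g : hom y z) (f : hom x y),
    fmap (g ∘ f) = fmap g ∘ fmap f
}.

Definition functor_id (C : Category) : Functor C C.
Proof. refine {| fobj x := x; fmap x y f := f |}; reflexivity. Defined.

Definition functor_comp (C D E : Category) (G : Functor D E) (F : Functor C D) :
  Functor C E.
Proof.
refine {| fobj x := G (F x); fmap x y f := fmap G (fmap F f) |}.
- abstract (intros; rewrite !fmap_id; reflexivity).
- abstract (intros; rewrite !fmap_comp; reflexivity).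
Defined.

Record NatTrans (C D : Category) (F G : Functor C D) : Type := {
  ntc :> forall x, hom (F x) (G x);
  nt_nat : forall x y (f : hom x y), ntc y ∘ fmap F f = fmap G f ∘ ntc x
}.

Definition nt_id (C D : Category) (F : Functor C D) : NatTrans F F.
Proof.
refine {| ntc x := idm (F x) |}.
abstract (intros; rewrite comp1m, compm1; reflexivity).
Defined.

Definition nt_vcomp (C D : Category) (F G H : Functor C D)
  (b : NatTrans G H) (a : NatTrans F G) : NatTrans F H.
Proof.
refine {| ntc x := b x ∘ a x |}.
abstract (intros; rewrite <- compA, nt_nat, compA, nt_nat, compA; reflexivity).
Defined.

Definition nt_hcomp (C D E : Category) (F F' : Functor C D) (H H' : Functor D E)
  (b : NatTrans H H') (a : NatTrans F F') :
  NatTrans (functor_comp H F) (functor_comp H' F').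
Proof.
refine (@Build_NatTrans _ _ (functor_comp H F) (functor_comp H' F')
          (fun x => fmap H' (a x) ∘ b (F x)) _).
abstract (intros; cbn; rewrite <- compA, nt_nat, !compA, <- !fmap_comp, nt_nat;
          reflexivity).
Defined.

Definition nt_whisker (B C D E : Category) (H : Functor D E) (F G : Functor C D)
  (a : NatTrans F G) (K : Functor B C) :
  NatTrans (functor_comp H (functor_comp F K)) (functor_comp H (functor_comp G K)).
Proof.
refine (@Build_NatTrans _ _ (functor_comp H (functor_comp F K))
          (functor_comp H (functor_comp G K)) (fun x => fmap H (a (K x))) _).
abstract (intros; cbn; rewrite <- !fmap_comp, nt_nat; reflexivity).
Defined.

Record Bicategory : Type := {
  cell0 :> Type;
  cell1 : cell0 -> cell0 -> Category;
  bid : forall X, cell1 X X;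
  bcomp : forall X Y Z, cell1 Y Z -> cell1 X Y -> cell1 X Z
    where "g ⋅ f" := (bcomp g f);
  bcomp2 : forall X Y Z (g g' : cell1 Y Z) (f f' : cell1 X Y),
    hom g g' -> hom f f' -> hom (g ⋅ f) (g' ⋅ f')
    where "t ⊗ s" := (bcomp2 t s);
  bcomp2_id : forall X Y Z (g : cell1 Y Z) (f : cell1 X Y),
    idm g ⊗ idm f = idm (g ⋅ f);
  bcomp2_comp : forall X Y Z (g g' g'' : cell1 Y Z) (f f' f'' : cell1 X Y)
    (t' : hom g' g'') (t : hom g g') (s' : hom f' f'') (s : hom f f'),
    (t' ∘ t) ⊗ (s' ∘ s) = (t' ⊗ s') ∘ (t ⊗ s);

  assoc : forall W X Y Z (h : cell1 Y Z) (g : cell1 X Y) (f : cell1 W X),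
    hom ((h ⋅ g) ⋅ f) (h ⋅ (g ⋅ f));
  lunit : forall X Y (f : cell1 X Y), hom (bid Y ⋅ f) f;
  runit : forall X Y (f : cell1 X Y), hom (f ⋅ bid X) f;
  assoc_iso : forall W X Y Z (h : cell1 Y Z) (g : cell1 X Y) (f : cell1 W X),
    is_iso (assoc h g f);
  lunit_iso : forall X Y (f : cell1 X Y), is_iso (lunit f);
  runit_iso : forall X Y (f : cell1 X Y), is_iso (runit f);
  assoc_nat : forall W X Y Z (h h' : cell1 Y Z) (g g' : cell1 X Y)
    (f f' : cell1 W X) (r : hom h h') (t : hom g g') (s : hom f f'),
    assoc h' g' f' ∘ ((r ⊗ t) ⊗ s) = (r ⊗ (t ⊗ s)) ∘ assoc h g f;
  lunit_nat : forall X Y (f f' : cell1 X Y) (s : hom f f'),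
    lunit f' ∘ (idm (bid Y) ⊗ s) = s ∘ lunit f;
  runit_nat : forall X Y (f f' : cell1 X Y) (s : hom f f'),
    runit f' ∘ (s ⊗ idm (bid X)) = s ∘ runit f;
  pentagon : forall V W X Y Z (k : cell1 Y Z) (h : cell1 X Y) (g : cell1 W X)
    (f : cell1 V W),
    assoc k h (g ⋅ f) ∘ assoc (k ⋅ h) g f =
    (idm k ⊗ assoc h g f) ∘ (assoc k (h ⋅ g) f ∘ (assoc k h g ⊗ idm f));
  triangle : forall X Y Z (g : cell1 Y Z) (f : cell1 X Y),
    (idm g ⊗ lunit f) ∘ assoc g (bid Y) f = runit g ⊗ idm f
}.
Notation "g ⋅ f" := (bcomp g f) : cat_scope.
Notation "t ⊗ s" := (bcomp2 t s) : cat_scope.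
Arguments bid {b} X.

Record LaxOn (A B : Bicategory) (o : A -> B) : Type := {
  lax_map : forall X Y, Functor (cell1 X Y) (cell1 (o X) (o Y));
  lax_mu : forall X Y Z (g : cell1 Y Z) (f : cell1 X Y),
    hom (lax_map Y Z g ⋅ lax_map X Y f) (lax_map X Z (g ⋅ f));
  lax_eta : forall X, hom (bid (o X)) (lax_map X X (bid X));
  lax_mu_nat : forall X Y Z (g g' : cell1 Y Z) (f f' : cell1 X Y)
    (t : hom g g') (s : hom f f'),
    lax_mu g' f' ∘ (fmap (lax_map Y Z) t ⊗ fmap (lax_map X Y) s) =
    fmap (lax_map X Z) (t ⊗ s) ∘ lax_mu g f;
  lax_assoc : forall W X Y Z (h : cell1 Y Z) (g : cell1 X Y) (f : cell1 W X),
    fmap (lax_map W Z) (assoc h g f) ∘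
      (lax_mu (h ⋅ g) f ∘ (lax_mu h g ⊗ idm (lax_map W X f))) =
    lax_mu h (g ⋅ f) ∘ ((idm (lax_map Y Z h) ⊗ lax_mu g f) ∘
      assoc (lax_map Y Z h) (lax_map X Y g) (lax_map W X f));
  lax_lunit : forall X Y (f : cell1 X Y),
    fmap (lax_map X Y) (lunit f) ∘
      (lax_mu (bid Y) f ∘ (lax_eta Y ⊗ idm (lax_map X Y f))) =
    lunit (lax_map X Y f);
  lax_runit : forall X Y (f : cell1 X Y),
    fmap (lax_map X Y) (runit f) ∘
      (lax_mu f (bid X) ∘ (idm (lax_map X Y f) ⊗ lax_eta X)) =
    runit (lax_map X Y f)
}.
Arguments lax_map {A B o} l {X Y}.

Record LaxFunctor (A B : Bicategory) : Type := MkLax {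
  lax_ob :> A -> B;
  lax_on :> LaxOn lax_ob
}.
Arguments MkLax {A B} lax_ob lax_on.

Definition lax_on_id (A : Bicategory) : LaxOn (fun X : A => X).
Proof.
refine (@Build_LaxOn A A (fun X => X) (fun X Y => functor_id (cell1 X Y))
  (fun X Y Z g f => idm (g ⋅ f)) (fun X => idm (bid X)) _ _ _ _);
abstract (intros; cbn; rewrite ?bcomp2_id, ?comp1m, ?compm1, ?bcomp2_id,
  ?comp1m, ?compm1; reflexivity).
Defined.

Section LaxOnComp.
Variables (A B C : Bicategory) (r : B -> C) (o : A -> B).
Variables (H : LaxOn r) (F : LaxOn o).

Let m X Y : Functor (cell1 X Y) (cell1 (r (o X)) (r (o Y))) :=
  functor_comp (lax_map H) (lax_map F).

Let mu X Y Z (g : cell1 Y Z) (f : cell1 X Y) : hom (m Y Z g ⋅ m X Y f) (m X Z (g ⋅ f)) :=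
  fmap (lax_map H) (lax_mu F g f) ∘ lax_mu H (lax_map F g) (lax_map F f).

Let eta X : hom (bid (r (o X))) (m X X (bid X)) :=
  fmap (lax_map H) (lax_eta F X) ∘ lax_eta H (o X).

Lemma lax_comp_mu_nat X Y Z (g g' : cell1 Y Z) (f f' : cell1 X Y)
    (t : hom g g') (s : hom f f') :
  mu g' f' ∘ (fmap (m Y Z) t ⊗ fmap (m X Y) s) = fmap (m X Z) (t ⊗ s) ∘ mu g f.
Proof.
unfold mu; cbn.
rewrite <- compA, lax_mu_nat, !compA, <- !fmap_comp, lax_mu_nat; reflexivity.
Qed.

Let whR X Y Z (g g' g'' : @cell1 C Y Z) (f : cell1 X Y) (t' : hom g' g'') (t : hom g g') :
  (t' ∘ t) ⊗ idm f = (t' ⊗ idm f) ∘ (t ⊗ idm f).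
Proof. rewrite <- bcomp2_comp, comp1m; reflexivity. Qed.

Let whL X Y Z (g : @cell1 C Y Z) (f f' f'' : cell1 X Y) (t' : hom f' f'') (t : hom f f') :
  idm g ⊗ (t' ∘ t) = (idm g ⊗ t') ∘ (idm g ⊗ t).
Proof. rewrite <- bcomp2_comp, comp1m; reflexivity. Qed.

Let muR X Y Z (g g' : @cell1 B Y Z) (f : cell1 X Y) (t : hom g g') :
  lax_mu H g' f ∘ (fmap (lax_map H) t ⊗ idm (lax_map H f)) =
  fmap (lax_map H) (t ⊗ idm f) ∘ lax_mu H g f.
Proof. rewrite <- fmap_id; apply lax_mu_nat. Qed.

Let muL X Y Z (g : @cell1 B Y Z) (f f' : cell1 X Y) (t : hom f f') :
  lax_mu H g f' ∘ (idm (lax_map H g) ⊗ fmap (lax_map H) t) =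
  fmap (lax_map H) (idm g ⊗ t) ∘ lax_mu H g f.
Proof. rewrite <- fmap_id; apply lax_mu_nat. Qed.

Lemma lax_comp_assoc W X Y Z (h : cell1 Y Z) (g : cell1 X Y) (f : cell1 W X) :
  fmap (m W Z) (assoc h g f) ∘ (mu (h ⋅ g) f ∘ (mu h g ⊗ idm (m W X f))) =
  mu h (g ⋅ f) ∘ ((idm (m Y Z h) ⊗ mu g f) ∘ assoc (m Y Z h) (m X Y g) (m W X f)).
Proof.
unfold mu; cbn; rewrite whR, whL.
rewrite <- !compA, (compA (lax_mu H _ _) (fmap _ _ ⊗ _)), muR.
rewrite (compA (lax_mu H _ _) (_ ⊗ fmap _ _)), muL.
rewrite <- !compA, <- lax_assoc, !compA, <- !fmap_comp, <- !compA, lax_assoc.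
reflexivity.
Qed.

Lemma lax_comp_lunit X Y (f : cell1 X Y) :
  fmap (m X Y) (lunit f) ∘ (mu (bid Y) f ∘ (eta Y ⊗ idm (m X Y f))) = lunit (m X Y f).
Proof.
unfold mu, eta; cbn; rewrite whR.
rewrite <- !compA, (compA (lax_mu H _ _) (fmap _ _ ⊗ _)), muR.
rewrite !compA, <- !fmap_comp, <- !compA, lax_lunit, lax_lunit; reflexivity.
Qed.

Lemma lax_comp_runit X Y (f : cell1 X Y) :
  fmap (m X Y) (runit f) ∘ (mu f (bid X) ∘ (idm (m X Y f) ⊗ eta X)) = runit (m X Y f).
Proof.
unfold mu, eta; cbn; rewrite whL.
rewrite <- !compA, (compA (lax_mu H _ _) (_ ⊗ fmap _ _)), muL.
rewrite !compA, <- !fmap_comp, <- !compA, lax_runit, lax_runit; reflexivity.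
Qed.

Definition lax_on_comp : LaxOn (fun X => r (o X)) :=
  @Build_LaxOn A C (fun X => r (o X)) m mu eta
    lax_comp_mu_nat lax_comp_assoc lax_comp_lunit lax_comp_runit.

End LaxOnComp.

Definition lax_id (A : Bicategory) : LaxFunctor A A := MkLax _ (lax_on_id A).

Definition lax_comp (A B C : Bicategory) (H : LaxFunctor B C) (F : LaxFunctor A B) :
  LaxFunctor A C := MkLax _ (lax_on_comp H F).

Record IconOn (A B : Bicategory) (o : A -> B) (F G : LaxOn o) : Type := {
  icon_nt : forall X Y, NatTrans (@lax_map _ _ _ F X Y) (@lax_map _ _ _ G X Y);
  icon_mu : forall X Y Z (g : cell1 Y Z) (f : cell1 X Y),
    lax_mu G g f ∘ (icon_nt Y Z g ⊗ icon_nt X Y f) =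
    icon_nt X Z (g ⋅ f) ∘ lax_mu F g f;
  icon_eta : forall X, icon_nt X X (bid X) ∘ lax_eta F X = lax_eta G X
}.
Arguments icon_nt {A B o F G} i {X Y}.

Definition icon_on_id (A B : Bicategory) (o : A -> B) (F : LaxOn o) : IconOn F F.
Proof.
refine {| icon_nt X Y := nt_id (lax_map F) |};
abstract (intros; cbn; rewrite ?bcomp2_id, ?comp1m, ?compm1; reflexivity).
Defined.

Definition icon_on_vcomp (A B : Bicategory) (o : A -> B) (F G H : LaxOn o)
  (b : IconOn G H) (a : IconOn F G) : IconOn F H.
Proof.
refine {| icon_nt X Y := nt_vcomp (icon_nt b) (icon_nt a) |}; intros; cbn.
- abstract (rewrite bcomp2_comp, compA, icon_mu, <- compA, icon_mu, compA; reflexivity).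
- abstract (rewrite <- compA, !icon_eta; reflexivity).
Defined.

Definition icon_on_hcomp (A B C : Bicategory) (r : B -> C) (o : A -> B)
  (H H' : LaxOn r) (F F' : LaxOn o) (b : IconOn H H') (a : IconOn F F') :
  IconOn (lax_on_comp H F) (lax_on_comp H' F').
Proof.
refine (@Build_IconOn _ _ _ (lax_on_comp H F) (lax_on_comp H' F')
          (fun X Y => nt_hcomp (icon_nt b) (icon_nt a)) _ _); intros; cbn.
- abstract (rewrite bcomp2_comp, <- compA, (compA (lax_mu H' _ _)), lax_mu_nat,
    <- compA, icon_mu, !compA, <- fmap_comp, icon_mu, fmap_comp, <- !compA;
    f_equal; rewrite !compA, nt_nat; reflexivity).
- abstract (rewrite <- compA, (compA (icon_nt b _)), nt_nat, <- compA, icon_eta,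
    compA, <- fmap_comp, icon_eta; reflexivity).
Defined.

(** [lax_along p G] is [G] regarded as having the object function [o]. *)
Definition lax_along (A B : Bicategory) (o o' : A -> B) (p : o = o') :
  LaxOn o' -> LaxOn o :=
  match p with eq_refl => fun G => G end.

(** Agreement on objects is equality of object functions; under functional
    extensionality this is the same as [forall X, F X = G X]. *)
Record Icon (A B : Bicategory) (F G : LaxFunctor A B) : Type := MkIcon {
  icon_ob : lax_ob F = lax_ob G;
  icon_on : IconOn (lax_on F) (lax_along icon_ob (lax_on G))
}.

Definition icon_of (A B : Bicategory) (o : A -> B) (F G : LaxOn o) (a : IconOn F G) :
  Icon (MkLax o F) (MkLax o G) :=
  @MkIcon A B (MkLax o F) (MkLax o G) eq_refl a.

Definition icon_id (A B : Bicategory) (F : LaxFunctor A B) : Icon F F :=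
  @MkIcon A B F F eq_refl (icon_on_id F).

Definition icon_vcomp_along (A B : Bicategory) (o1 o2 o3 : A -> B)
  (p : o1 = o2) (q : o2 = o3) :
  forall (F : LaxOn o1) (G : LaxOn o2) (H : LaxOn o3),
    IconOn G (lax_along q H) -> IconOn F (lax_along p G) ->
    IconOn F (lax_along (eq_trans p q) H) :=
  match q in _ = o3 return
    forall (F : LaxOn o1) (G : LaxOn o2) (H : LaxOn o3),
      IconOn G (lax_along q H) -> IconOn F (lax_along p G) ->
      IconOn F (lax_along (eq_trans p q) H)
  with eq_refl =>
    match p in _ = o2 return
      forall (F : LaxOn o1) (G H : LaxOn o2),
        IconOn G H -> IconOn F (lax_along p G) -> IconOn F (lax_along p H)
    with eq_refl => fun F G H b a => icon_on_vcomp b a end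
  end.

Definition icon_vcomp (A B : Bicategory) (F G H : LaxFunctor A B)
  (b : Icon G H) (a : Icon F G) : Icon F H :=
  MkIcon (icon_vcomp_along (icon_on b) (icon_on a)).

Definition ob_comp_eq (A B C : Type) (r r' : B -> C) (o o' : A -> B)
  (q : r = r') (p : o = o') : (fun X => r (o X)) = (fun X => r' (o' X)) :=
  match q, p with eq_refl, eq_refl => eq_refl end.

Definition icon_hcomp_along (A B C : Bicategory) (r r' : B -> C) (o o' : A -> B)
  (q : r = r') (p : o = o') :
  forall (H : LaxOn r) (H' : LaxOn r') (F : LaxOn o) (F' : LaxOn o'),
    IconOn H (lax_along q H') -> IconOn F (lax_along p F') ->
    IconOn (lax_on_comp H F) (lax_along (ob_comp_eq q p) (lax_on_comp H' F')) :=
  match q, p with eq_refl, eq_refl => fun H H' F F' b a => icon_on_hcomp b a end.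

Definition icon_hcomp (A B C : Bicategory) (H H' : LaxFunctor B C)
  (F F' : LaxFunctor A B) (b : Icon H H') (a : Icon F F') :
  Icon (lax_comp H F) (lax_comp H' F') :=
  @MkIcon A C (lax_comp H F) (lax_comp H' F') _
    (icon_hcomp_along (icon_on b) (icon_on a)).

Record TwoCatData : Type := {
  tc_ob : Type;
  tc_hom1 : tc_ob -> tc_ob -> Type;
  tc_hom2 : forall X Y, tc_hom1 X Y -> tc_hom1 X Y -> Type;
  tc_id1 : forall X, tc_hom1 X X;
  tc_comp : forall X Y Z, tc_hom1 Y Z -> tc_hom1 X Y -> tc_hom1 X Z;
  tc_id2 : forall X Y (f : tc_hom1 X Y), tc_hom2 f f;
  tc_vcomp : forall X Y (f g h : tc_hom1 X Y),
    tc_hom2 g h -> tc_hom2 f g -> tc_hom2 f h;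
  tc_hcomp : forall X Y Z (g g' : tc_hom1 Y Z) (f f' : tc_hom1 X Y),
    tc_hom2 g g' -> tc_hom2 f f' -> tc_hom2 (tc_comp g f) (tc_comp g' f')
}.
Arguments tc_id1 : clear implicits.

(** A 2-cell together with its source and target.  Equations between 2-cells
    whose boundaries agree only propositionally are stated in this type; such
    an equation includes the equality of the boundaries. *)
Record BoundedCell (D : TwoCatData) (X Y : tc_ob D) : Type := MkBounded {
  bc_src : tc_hom1 X Y;
  bc_tgt : tc_hom1 X Y;
  bc_cell : tc_hom2 bc_src bc_tgt
}.

Record is_two_category (D : TwoCatData) : Prop := {
  tc_vcompA : forall (X Y : tc_ob D) (f g h k : tc_hom1 X Y)
    (c : tc_hom2 h k) (b : tc_hom2 g h) (a : tc_hom2 f g),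
    tc_vcomp c (tc_vcomp b a) = tc_vcomp (tc_vcomp c b) a;
  tc_vcomp1m : forall (X Y : tc_ob D) (f g : tc_hom1 X Y) (a : tc_hom2 f g),
    tc_vcomp (tc_id2 g) a = a;
  tc_vcompm1 : forall (X Y : tc_ob D) (f g : tc_hom1 X Y) (a : tc_hom2 f g),
    tc_vcomp a (tc_id2 f) = a;

  tc_hcomp_id : forall (X Y Z : tc_ob D) (g : tc_hom1 Y Z) (f : tc_hom1 X Y),
    tc_hcomp (tc_id2 g) (tc_id2 f) = tc_id2 (tc_comp g f);
  tc_interchange : forall (X Y Z : tc_ob D) (g g' g'' : tc_hom1 Y Z)
    (f f' f'' : tc_hom1 X Y) (b' : tc_hom2 g' g'') (b : tc_hom2 g g')
    (a' : tc_hom2 f' f'') (a : tc_hom2 f f'),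
    tc_hcomp (tc_vcomp b' b) (tc_vcomp a' a) =
    tc_vcomp (tc_hcomp b' a') (tc_hcomp b a);

  tc_compA : forall (W X Y Z : tc_ob D) (h : tc_hom1 Y Z) (g : tc_hom1 X Y)
    (f : tc_hom1 W X),
    tc_comp h (tc_comp g f) = tc_comp (tc_comp h g) f;
  tc_comp1m : forall (X Y : tc_ob D) (f : tc_hom1 X Y), tc_comp (tc_id1 D Y) f = f;
  tc_compm1 : forall (X Y : tc_ob D) (f : tc_hom1 X Y), tc_comp f (tc_id1 D X) = f;

  tc_hcompA : forall (W X Y Z : tc_ob D) (h h' : tc_hom1 Y Z) (g g' : tc_hom1 X Y)
    (f f' : tc_hom1 W X) (c : tc_hom2 h h') (b : tc_hom2 g g') (a : tc_hom2 f f'),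
    MkBounded (tc_hcomp c (tc_hcomp b a)) = MkBounded (tc_hcomp (tc_hcomp c b) a);
  tc_hcomp1m : forall (X Y : tc_ob D) (f f' : tc_hom1 X Y) (a : tc_hom2 f f'),
    MkBounded (tc_hcomp (tc_id2 (tc_id1 D Y)) a) = MkBounded a;
  tc_hcompm1 : forall (X Y : tc_ob D) (f f' : tc_hom1 X Y) (a : tc_hom2 f f'),
    MkBounded (tc_hcomp a (tc_id2 (tc_id1 D X))) = MkBounded a
}.

Definition Bicat2 : TwoCatData := {|
  tc_ob := Bicategory;
  tc_hom1 := LaxFunctor;
  tc_hom2 := Icon;
  tc_id1 := lax_id;
  tc_comp := lax_comp;
  tc_id2 := icon_id;
  tc_vcomp := icon_vcomp;
  tc_hcomp := icon_hcomp
|}.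

(* Main.v *)
(** An icon between lax functors that agree on objects is a family of natural
    transformations between their hom-functors, and it composes as such; hence
    the axioms for icons are inherited from the 2-category of categories,
    functors and natural transformations.  Likewise lax functors compose
    strictly, since their hom-functors do and the two ways of forming the
    constraints of a threefold composite differ only by functoriality and by
    associativity of vertical composition in a hom-category.

    The components of two lax functors to be proved equal lie in types that
    agree only propositionally, and so do those of two icons between such lax
    functors; they are compared as arrows bundled with their endpoints. *)

Require Import Defs.
From Stdlib Require Import FunctionalExtensionality ProofIrrelevance.
Local Open Scope cat_scope.

Set Implicit Arguments.
Unset Strict Implicit.

Record Arrow (C : Category) : Type := MkArrow {
  arr_src : C;
  arr_tgt : C;
  arr : hom arr_src arr_tgt
}.

Lemma MkArrow_congr (C : Category) (x y : C) (f g : hom x y) :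
  f = g -> MkArrow f = MkArrow g.
Proof. intros ->; reflexivity. Qed.

Lemma MkArrow_inj (C : Category) (x y : C) (f g : hom x y) :
  MkArrow f = MkArrow g -> f = g.
Proof.
intro e; injection e; intro e_arr.
apply inj_pairT2 in e_arr; apply inj_pairT2 in e_arr; exact e_arr.
Qed.

Lemma functor_ext (C D : Category) (F G : Functor C D) :
  (forall x y (f : hom x y), MkArrow (fmap F f) = MkArrow (fmap G f)) -> F = G.
Proof.
destruct F as [Fo Fm F1 FM], G as [Go Gm G1 GM]; cbn; intro e.
assert (e_obj : Fo = Go)
  by (extensionality x; exact (f_equal (@arr_src _) (e x x (idm x)))).
destruct e_obj.
assert (e_hom : Fm = Gm)
  by (extensionality x; extensionality y; extensionality f; apply MkArrow_inj, e).
destruct e_hom; f_equal; apply proof_irrelevance.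
Qed.

Lemma functor_compA (B C D E : Category) (H : Functor D E) (G : Functor C D)
    (F : Functor B C) :
  functor_comp H (functor_comp G F) = functor_comp (functor_comp H G) F.
Proof. apply functor_ext; reflexivity. Qed.

Lemma functor_comp1m (C D : Category) (F : Functor C D) :
  functor_comp (functor_id D) F = F.
Proof. apply functor_ext; reflexivity. Qed.

Lemma functor_compm1 (C D : Category) (F : Functor C D) :
  functor_comp F (functor_id C) = F.
Proof. apply functor_ext; reflexivity. Qed.

Lemma nt_ext (C D : Category) (F G : Functor C D) (a b : NatTrans F G) :
  (forall x, a x = b x) -> a = b.
Proof.
destruct a as [a a_nat], b as [b b_nat]; cbn; intro e.
assert (e_ntc : a = b) by (extensionality x; apply e).
destruct e_ntc; f_equal; apply proof_irrelevance.
Qed.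

Lemma nt_vcompA (C D : Category) (F G H K : Functor C D) (c : NatTrans H K)
    (b : NatTrans G H) (a : NatTrans F G) :
  nt_vcomp c (nt_vcomp b a) = nt_vcomp (nt_vcomp c b) a.
Proof. apply nt_ext; intro x; apply compA. Qed.

Lemma nt_vcomp1m (C D : Category) (F G : Functor C D) (a : NatTrans F G) :
  nt_vcomp (nt_id G) a = a.
Proof. apply nt_ext; intro x; apply comp1m. Qed.

Lemma nt_vcompm1 (C D : Category) (F G : Functor C D) (a : NatTrans F G) :
  nt_vcomp a (nt_id F) = a.
Proof. apply nt_ext; intro x; apply compm1. Qed.

Lemma nt_hcomp_id (C D E : Category) (G : Functor D E) (F : Functor C D) :
  nt_hcomp (nt_id G) (nt_id F) = nt_id (functor_comp G F).
Proof. apply nt_ext; intro x; cbn; rewrite fmap_id; apply comp1m. Qed.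

Lemma nt_interchange (C D E : Category) (G G' G'' : Functor D E)
    (F F' F'' : Functor C D) (b' : NatTrans G' G'') (b : NatTrans G G')
    (a' : NatTrans F' F'') (a : NatTrans F F') :
  nt_hcomp (nt_vcomp b' b) (nt_vcomp a' a) =
  nt_vcomp (nt_hcomp b' a') (nt_hcomp b a).
Proof.
apply nt_ext; intro x; cbn.
rewrite fmap_comp, <- !compA, (compA (b' _)), nt_nat, !compA; reflexivity.
Qed.

Lemma nt_hcompA (B C D E : Category) (H H' : Functor D E) (G G' : Functor C D)
    (F F' : Functor B C) (c : NatTrans H H') (b : NatTrans G G')
    (a : NatTrans F F') (x : B) :
  nt_hcomp c (nt_hcomp b a) x = nt_hcomp (nt_hcomp c b) a x.
Proof. cbn; rewrite fmap_comp, compA; reflexivity. Qed.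

Lemma nt_hcomp1m (C D : Category) (F G : Functor C D) (a : NatTrans F G) (x : C) :
  nt_hcomp (nt_id (functor_id D)) a x = a x.
Proof. apply compm1. Qed.

Lemma nt_hcompm1 (C D : Category) (F G : Functor C D) (a : NatTrans F G) (x : C) :
  nt_hcomp a (nt_id (functor_id C)) x = a x.
Proof. cbn; rewrite fmap_id; apply comp1m. Qed.

Lemma nt_whiskerE (B C D E : Category) (H : Functor D E) (F G : Functor C D)
    (a : NatTrans F G) (K : Functor B C) :
  nt_hcomp (nt_id H) (nt_hcomp a (nt_id K)) = nt_whisker H a K.
Proof.
apply nt_ext; intro x; cbn; rewrite compm1, fmap_id, comp1m; reflexivity.
Qed.

Lemma lax_on_ext (A B : Bicategory) (o : A -> B) (F G : LaxOn o) :
  (forall X Y, @lax_map _ _ _ F X Y = @lax_map _ _ _ G X Y) ->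
  (forall X Y Z (g : cell1 Y Z) (f : cell1 X Y),
     MkArrow (lax_mu F g f) = MkArrow (lax_mu G g f)) ->
  (forall X, MkArrow (lax_eta F X) = MkArrow (lax_eta G X)) ->
  F = G.
Proof.
destruct F as [Fm Fmu Feta F_nat F_assoc F_lunit F_runit].
destruct G as [Gm Gmu Geta G_nat G_assoc G_lunit G_runit]; cbn.
intros map_eq mu_eq eta_eq.
assert (e_map : Fm = Gm) by (extensionality X; extensionality Y; apply map_eq).
destruct e_map.
assert (e_mu : Fmu = Gmu)
  by (extensionality X; extensionality Y; extensionality Z;
      extensionality g; extensionality f; apply MkArrow_inj, mu_eq).
destruct e_mu.
assert (e_eta : Feta = Geta) by (extensionality X; apply MkArrow_inj, eta_eq).
destruct e_eta; f_equal; apply proof_irrelevance.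
Qed.

Lemma lax_on_compA (A B C D : Bicategory) (q : C -> D) (r : B -> C) (o : A -> B)
    (H : LaxOn q) (G : LaxOn r) (F : LaxOn o) :
  lax_on_comp H (lax_on_comp G F) = lax_on_comp (lax_on_comp H G) F.
Proof.
apply lax_on_ext; intros.
- apply functor_compA.
- apply MkArrow_congr; cbn; rewrite fmap_comp, compA; reflexivity.
- apply MkArrow_congr; cbn; rewrite fmap_comp, compA; reflexivity.
Qed.

Lemma lax_on_comp1m (A B : Bicategory) (o : A -> B) (F : LaxOn o) :
  lax_on_comp (lax_on_id B) F = F.
Proof.
apply lax_on_ext; intros.
- apply functor_comp1m.
- apply MkArrow_congr, compm1.
- apply MkArrow_congr, compm1.
Qed.

Lemma lax_on_compm1 (A B : Bicategory) (o : A -> B) (F : LaxOn o) :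
  lax_on_comp F (lax_on_id A) = F.
Proof.
apply lax_on_ext; intros.
- apply functor_compm1.
- apply MkArrow_congr; cbn; rewrite fmap_id; apply comp1m.
- apply MkArrow_congr; cbn; rewrite fmap_id; apply comp1m.
Qed.

Lemma lax_compA (A B C D : Bicategory) (H : LaxFunctor C D) (G : LaxFunctor B C)
    (F : LaxFunctor A B) :
  lax_comp H (lax_comp G F) = lax_comp (lax_comp H G) F.
Proof. exact (f_equal (MkLax _) (lax_on_compA H G F)). Qed.

Lemma lax_comp1m (A B : Bicategory) (F : LaxFunctor A B) :
  lax_comp (lax_id B) F = F.
Proof. destruct F as [o F]; exact (f_equal (MkLax o) (lax_on_comp1m F)). Qed.

Lemma lax_compm1 (A B : Bicategory) (F : LaxFunctor A B) :
  lax_comp F (lax_id A) = F.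
Proof. destruct F as [o F]; exact (f_equal (MkLax o) (lax_on_compm1 F)). Qed.

Lemma icon_on_ext (A B : Bicategory) (o : A -> B) (F G : LaxOn o)
    (a b : IconOn F G) :
  (forall X Y, @icon_nt _ _ _ _ _ a X Y = @icon_nt _ _ _ _ _ b X Y) -> a = b.
Proof.
destruct a as [a a_mu a_eta], b as [b b_mu b_eta]; cbn; intro e.
assert (e_nt : a = b) by (extensionality X; extensionality Y; apply e).
destruct e_nt; f_equal; apply proof_irrelevance.
Qed.

Lemma icon_on_vcompA (A B : Bicategory) (o : A -> B) (F G H K : LaxOn o)
    (c : IconOn H K) (b : IconOn G H) (a : IconOn F G) :
  icon_on_vcomp c (icon_on_vcomp b a) = icon_on_vcomp (icon_on_vcomp c b) a.
Proof. apply icon_on_ext; intros; apply nt_vcompA. Qed.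

Lemma icon_on_vcomp1m (A B : Bicategory) (o : A -> B) (F G : LaxOn o)
    (a : IconOn F G) :
  icon_on_vcomp (icon_on_id G) a = a.
Proof. apply icon_on_ext; intros; apply nt_vcomp1m. Qed.

Lemma icon_on_vcompm1 (A B : Bicategory) (o : A -> B) (F G : LaxOn o)
    (a : IconOn F G) :
  icon_on_vcomp a (icon_on_id F) = a.
Proof. apply icon_on_ext; intros; apply nt_vcompm1. Qed.

Lemma icon_on_hcomp_id (A B C : Bicategory) (r : B -> C) (o : A -> B)
    (G : LaxOn r) (F : LaxOn o) :
  icon_on_hcomp (icon_on_id G) (icon_on_id F) = icon_on_id (lax_on_comp G F).
Proof. apply icon_on_ext; intros; apply nt_hcomp_id. Qed.

Lemma icon_on_interchange (A B C : Bicategory) (r : B -> C) (o : A -> B)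
    (G G' G'' : LaxOn r) (F F' F'' : LaxOn o) (b' : IconOn G' G'')
    (b : IconOn G G') (a' : IconOn F' F'') (a : IconOn F F') :
  icon_on_hcomp (icon_on_vcomp b' b) (icon_on_vcomp a' a) =
  icon_on_vcomp (icon_on_hcomp b' a') (icon_on_hcomp b a).
Proof. apply icon_on_ext; intros; apply nt_interchange. Qed.

Definition icon_on_whisker (A B C D : Bicategory) (r : B -> C) (o : A -> B)
    (k : D -> A) (H : LaxOn r) (F G : LaxOn o) (a : IconOn F G) (K : LaxOn k) :
    IconOn (lax_on_comp H (lax_on_comp F K)) (lax_on_comp H (lax_on_comp G K)) :=
  icon_on_hcomp (icon_on_id H) (icon_on_hcomp a (icon_on_id K)).

Lemma icon_on_whisker_nt (A B C D : Bicategory) (r : B -> C) (o : A -> B)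
    (k : D -> A) (H : LaxOn r) (F G : LaxOn o) (a : IconOn F G) (K : LaxOn k)
    (X Y : D) :
  @icon_nt _ _ _ _ _ (icon_on_whisker H a K) X Y =
  nt_whisker (lax_map H) (icon_nt a) (lax_map K).
Proof. apply nt_whiskerE. Qed.

(** The source is kept in the form [MkLax o F] so that the case analysis can be
    repeated along a chain of vertically composable icons. *)
Variant icon_spec (A B : Bicategory) (o : A -> B) (F : LaxOn o) :
    forall G : LaxFunctor A B, Icon (MkLax o F) G -> Prop :=
  IconSpec (G : LaxOn o) (a : IconOn F G) : icon_spec (icon_of a).

Lemma iconP (A B : Bicategory) (o : A -> B) (F : LaxOn o) (G : LaxFunctor A B)
    (a : Icon (MkLax o F) G) :
  icon_spec a.
Proof.
destruct G as [o' G], a as [p a]; cbn in p, a; destruct p; constructor.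
Qed.

Lemma icon_vcompA (A B : Bicategory) (F G H K : LaxFunctor A B)
    (c : Icon H K) (b : Icon G H) (a : Icon F G) :
  icon_vcomp c (icon_vcomp b a) = icon_vcomp (icon_vcomp c b) a.
Proof.
destruct F as [o F]; destruct (iconP a) as [G a].
destruct (iconP b) as [H b]; destruct (iconP c) as [K c].
exact (f_equal (@icon_of _ _ _ _ _) (icon_on_vcompA c b a)).
Qed.

Lemma icon_vcomp1m (A B : Bicategory) (F G : LaxFunctor A B) (a : Icon F G) :
  icon_vcomp (icon_id G) a = a.
Proof.
destruct F as [o F]; destruct (iconP a) as [G a].
exact (f_equal (@icon_of _ _ _ _ _) (icon_on_vcomp1m a)).
Qed.

Lemma icon_vcompm1 (A B : Bicategory) (F G : LaxFunctor A B) (a : Icon F G) :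
  icon_vcomp a (icon_id F) = a.
Proof.
destruct F as [o F]; destruct (iconP a) as [G a].
exact (f_equal (@icon_of _ _ _ _ _) (icon_on_vcompm1 a)).
Qed.

Lemma icon_hcomp_id (A B C : Bicategory) (G : LaxFunctor B C)
    (F : LaxFunctor A B) :
  icon_hcomp (icon_id G) (icon_id F) = icon_id (lax_comp G F).
Proof.
exact (f_equal (@icon_of _ _ _ _ _) (icon_on_hcomp_id G F)).
Qed.

Lemma icon_interchange (A B C : Bicategory) (G G' G'' : LaxFunctor B C)
    (F F' F'' : LaxFunctor A B) (b' : Icon G' G'') (b : Icon G G')
    (a' : Icon F' F'') (a : Icon F F') :
  icon_hcomp (icon_vcomp b' b) (icon_vcomp a' a) =
  icon_vcomp (icon_hcomp b' a') (icon_hcomp b a).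
Proof.
destruct F as [o F]; destruct (iconP a) as [F' a].
destruct (iconP a') as [F'' a'].
destruct G as [r G]; destruct (iconP b) as [G' b].
destruct (iconP b') as [G'' b'].
exact (f_equal (@icon_of _ _ _ _ _) (icon_on_interchange b' b a' a)).
Qed.

Lemma bounded_icon_ext (A B : Bicategory) (o : A -> B) (F F' G G' : LaxOn o)
    (a : IconOn F G) (a' : IconOn F' G') :
  F = F' -> G = G' ->
  (forall X Y (f : cell1 X Y), MkArrow (icon_nt a f) = MkArrow (icon_nt a' f)) ->
  @MkBounded Bicat2 A B _ _ (icon_of a) = @MkBounded Bicat2 A B _ _ (icon_of a').
Proof.
intros F_eq G_eq; destruct F_eq, G_eq; intro nt_eq.
assert (e_icon : a = a')
  by (apply icon_on_ext; intros; apply nt_ext; intro f; apply MkArrow_inj, nt_eq).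
destruct e_icon; reflexivity.
Qed.

Lemma icon_hcompA (A B C D : Bicategory) (H H' : LaxFunctor C D)
    (G G' : LaxFunctor B C) (F F' : LaxFunctor A B)
    (c : Icon H H') (b : Icon G G') (a : Icon F F') :
  @MkBounded Bicat2 A D _ _ (icon_hcomp c (icon_hcomp b a)) =
  @MkBounded Bicat2 A D _ _ (icon_hcomp (icon_hcomp c b) a).
Proof.
destruct F as [o F]; destruct (iconP a) as [F' a].
destruct G as [r G]; destruct (iconP b) as [G' b].
destruct H as [q H]; destruct (iconP c) as [H' c].
apply (bounded_icon_ext (lax_on_compA H G F) (lax_on_compA H' G' F')).
intros; apply MkArrow_congr, nt_hcompA.
Qed.

Lemma icon_hcomp1m (A B : Bicategory) (F F' : LaxFunctor A B) (a : Icon F F') :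
  @MkBounded Bicat2 A B _ _ (icon_hcomp (icon_id (lax_id B)) a) =
  @MkBounded Bicat2 A B _ _ a.
Proof.
destruct F as [o F]; destruct (iconP a) as [F' a].
apply (bounded_icon_ext (lax_on_comp1m F) (lax_on_comp1m F')).
intros; apply MkArrow_congr, nt_hcomp1m.
Qed.

Lemma icon_hcompm1 (A B : Bicategory) (F F' : LaxFunctor A B) (a : Icon F F') :
  @MkBounded Bicat2 A B _ _ (icon_hcomp a (icon_id (lax_id A))) =
  @MkBounded Bicat2 A B _ _ a.
Proof.
destruct F as [o F]; destruct (iconP a) as [F' a].
apply (bounded_icon_ext (lax_on_compm1 F) (lax_on_compm1 F')).
intros; apply MkArrow_congr, nt_hcompm1.
Qed.

Lemma Bicat2_is_two_category : is_two_category Bicat2.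
Proof.
exact (@Build_is_two_category Bicat2
  icon_vcompA icon_vcomp1m icon_vcompm1
  icon_hcomp_id icon_interchange
  lax_compA lax_comp1m lax_compm1
  icon_hcompA icon_hcomp1m icon_hcompm1).
Qed.

Theorem theorem3p2 :
  is_two_category Bicat2
  /\ (* (1) composition of lax functors *)
  (forall (A B C : Bicategory) (H : LaxFunctor B C) (F : LaxFunctor A B),
     let HF : LaxFunctor A C := @tc_comp Bicat2 A B C H F in
     (forall X : A, HF X = H (F X)) /\
     (forall X Y : A, @lax_map _ _ _ HF X Y = functor_comp (lax_map H) (lax_map F)) /\
     (forall (X Y Z : A) (g : cell1 Y Z) (f : cell1 X Y),
        lax_mu HF g f =
        fmap (lax_map H) (lax_mu F g f) ∘ lax_mu H (lax_map F g) (lax_map F f)) /\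
     (forall X : A,
        lax_eta HF X = fmap (lax_map H) (lax_eta F X) ∘ lax_eta H (F X)))
  /\ (* (2) vertical composition of icons *)
  (forall (A B : Bicategory) (o : A -> B) (F G H : LaxOn o)
          (b : IconOn G H) (a : IconOn F G),
     let ba : Icon (MkLax o F) (MkLax o H) :=
       @tc_vcomp Bicat2 A B (MkLax o F) (MkLax o G) (MkLax o H) (icon_of b) (icon_of a) in
     exists c : IconOn F H,
       ba = icon_of c /\
       forall X Y : A, @icon_nt _ _ _ _ _ c X Y = nt_vcomp (icon_nt b) (icon_nt a))
  /\ (* (3) whiskering of icons *)
  (forall (A B C D : Bicategory) (o : A -> B) (H : LaxFunctor B C)
          (F G : LaxOn o) (a : IconOn F G) (K : LaxFunctor D A),
     let HFK : LaxFunctor D C := lax_comp H (lax_comp (MkLax o F) K) in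
     let HGK : LaxFunctor D C := lax_comp H (lax_comp (MkLax o G) K) in
     let HaK : Icon HFK HGK :=
       @tc_hcomp Bicat2 D B C H H _ _ (@tc_id2 Bicat2 B C H)
         (@tc_hcomp Bicat2 D A B (MkLax o F) (MkLax o G) K K
            (icon_of a) (@tc_id2 Bicat2 D A K)) in
     exists c : IconOn (lax_on HFK) (lax_on HGK),
       HaK = icon_of c /\
       (forall X Y : D,
          @icon_nt _ _ _ _ _ c X Y = nt_whisker (lax_map H) (icon_nt a) (lax_map K)) /\
       (forall (X Y : D) (f : cell1 X Y),
          icon_nt c f = fmap (lax_map H) (icon_nt a (lax_map K f)))).
Proof.
split; [exact Bicat2_is_two_category | split; [| split]].
- repeat split.
- intros; exists (icon_on_vcomp b a); split; reflexivity.
- intros; exists (icon_on_whisker H a K); split; [reflexivity | split; intros].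
  + exact (icon_on_whisker_nt H a K X Y).
  + exact (f_equal (fun t => ntc t f) (icon_on_whisker_nt H a K X Y)).
Qed.
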